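(* Let $\alpha>-1$ and $x>0$ be real, and let $(e_n)_{n\ge 0}$ be the error sequence of the three-term recurrence for the generalized Laguerre polynomials at $x$, i.e. $$e_{n+1}=\frac{2n+\alpha+1-x}{n+1}\,e_n-\frac{n+\alpha}{n+1}\,e_{n-1}+\zeta_n\quad(n\ge 1),\qquad e_0=0,\qquad e_1=\mathcal{L}_1^{(\alpha)}(x)\,\eta_0^a,$$ where $\zeta_n$ is the round-off term defined in the context. For $n\ge 1$ put $$E_n:=x\,e_n^2+(n+\alpha)(e_n-e_{n-1})^2 .$$ Then for any $\eta>0$ with $3-\alpha-x-\eta>0$, and with $$\beta_n:=\frac{\Gamma(n+2+\alpha)/\Gamma(2+\alpha)}{\Gamma(n+3-\alpha-x-\eta)/\Gamma(3-\alpha-x-\eta)},$$ the following estimates hold for all $n\ge 1$: (i) if $1-2\alpha-x-\eta\ge 0$, then $$E_{n+1}\le E_1+\frac{(n+1)(n+2)(2n+3)}{6\eta}\max_{1\le s\le n}\zeta_s^2;$$ (ii) if $-1.5<1-2\alpha-x-\eta<0$ and $\alpha\ge 0$, then $$E_{n+1}\le \beta_n E_1+\frac{(n-3)(n+1)^2+29\beta_n}{\eta}\max_{1\le s\le n}\zeta_s^2 .$$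
   Context: For $\alpha>-1$, the generalized Laguerre polynomials $\mathcal{L}_n^{(\alpha)}$ are defined by $\mathcal{L}_0^{(\alpha)}(x)=1$, $\mathcal{L}_1^{(\alpha)}(x)=-x+\alpha+1$, and $(n+1)\mathcal{L}_{n+1}^{(\alpha)}(x)=(2n+\alpha+1-x)\mathcal{L}_n^{(\alpha)}(x)-(n+\alpha)\mathcal{L}_{n-1}^{(\alpha)}(x)$ for $n\ge 1$; they are considered for $x\in\mathbb{R}_+=(0,+\infty)$. Round-off model: the real numbers $\eta_x$, $\eta_n^a$, $\eta_n^b$ are the relative round-off errors of the corresponding coefficients of the recurrence, and $\eta_0^a$ is the relative error of the computed value of $\mathcal{L}_1^{(\alpha)}(x)$ (all of the order of the relative round-off bound $\varepsilon$ of the floating-point system). The computed values are $\mathcal{L}_n^{(\alpha)}(x)+e_n$, where $e_n$ is the (absolute) error, and they satisfy, for $n\ge 1$, $$\mathcal{L}_{n+1}^{(\alpha)}+e_{n+1}=\frac{2n+\alpha+1-x(1+\eta_x)}{n+1}(1+\eta_n^a)(\mathcal{L}_n^{(\alpha)}+e_n)-\frac{n+\alpha}{n+1}(1+\eta_n^b)(\mathcal{L}_{n-1}^{(\alpha)}+e_{n-1}),$$ all polynomials being evaluated at $x$. Equivalently, $e_n$ satisfies the recurrence displayed in the claim with $$\zeta_n=\xi_n-\frac{x}{n+1}\mathcal{L}_n^{(\alpha)}\eta_x+\frac{2n+\alpha+1-x}{n+1}\mathcal{L}_n^{(\alpha)}\eta_n^a-\frac{n+\alpha}{n+1}\mathcal{L}_{n-1}^{(\alpha)}\eta_n^b,$$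 where $\xi_n$ collects the remaining (higher-order) terms, namely $$\xi_n=-\frac{x}{n+1}\eta_x\big[(1+\eta_n^a)(\mathcal{L}_n^{(\alpha)}+e_n)-\mathcal{L}_n^{(\alpha)}\big]+\frac{2n+\alpha+1-x}{n+1}\eta_n^a e_n-\frac{n+\alpha}{n+1}\eta_n^b e_{n-1}.$$ $\Gamma$ denotes the Gamma function. *)

(* Defs.v *)
From HB Require Import structures.
From mathcomp Require Import all_boot all_order all_algebra.
From mathcomp Require Import all_classical all_reals all_analysis.

Set Implicit Arguments.
Unset Strict Implicit.
Unset Printing Implicit Defensive.

Import Order.TTheory GRing.Theory Num.Theory.
Import numFieldNormedType.Exports.

Local Open Scope classical_set_scope.
Local Open Scope ring_scope.

(* The generalized Laguerre polynomials. In the last case n = k.+1 >= 1 and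
   the recurrence, divided by n + 1, produces the polynomial of index n + 1. *)
Fixpoint laguerre (R : realType) (alpha : R) (m : nat) : {poly R} :=
  match m with
  | 0 => 1
  | n.+1 =>
    match n with
    | 0 => (alpha + 1)%:P - 'X
    | k.+1 =>
      (n.+1%:R : R)^-1 *:
        (((2 * n%:R + alpha + 1)%:P - 'X) * laguerre alpha n
         - (n%:R + alpha) *: laguerre alpha k)
    end
  end.

(* Euler's integral; it converges for z > 0. For z <= 0 the value is junk
   (0, as the integral is infinite), not the analytic continuation. *)
Definition Gamma (R : realType) (z : R) : R :=
  \int[@lebesgue_measure R]_(t in `]0, +oo[) (t `^ (z - 1) * expR (- t)).

(* The round-off terms xi_n and zeta_n for n >= 1 (n.-1 is then n - 1), where
   etax, etaa n, etab n are the relative errors of the coefficients and e n is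
   the absolute error of the computed value of the n-th polynomial at x. *)
Definition xi (R : realType) (alpha x etax : R) (etaa etab e : nat -> R)
    (n : nat) : R :=
  - (x / n.+1%:R * etax *
      ((1 + etaa n) * ((laguerre alpha n).[x] + e n) - (laguerre alpha n).[x]))
  + (2 * n%:R + alpha + 1 - x) / n.+1%:R * etaa n * e n
  - (n%:R + alpha) / n.+1%:R * etab n * e n.-1.

Definition zeta (R : realType) (alpha x etax : R) (etaa etab e : nat -> R)
    (n : nat) : R :=
  xi alpha x etax etaa etab e n
  - x / n.+1%:R * (laguerre alpha n).[x] * etax
  + (2 * n%:R + alpha + 1 - x) / n.+1%:R * (laguerre alpha n).[x] * etaa n
  - (n%:R + alpha) / n.+1%:R * (laguerre alpha n.-1).[x] * etab n.

Definition energy (R : realType) (alpha x : R) (e : nat -> R) (n : nat) : R :=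
  x * e n ^+ 2 + (n%:R + alpha) * (e n - e n.-1) ^+ 2.

Definition beta_coef (R : realType) (alpha x eta : R) (n : nat) : R :=
  (Gamma (n%:R + 2 + alpha) / Gamma (2 + alpha)) /
  (Gamma (n%:R + 3 - alpha - x - eta) / Gamma (3 - alpha - x - eta)).

(* The maximum of u_s ^ 2 over 1 <= s <= n, for n >= 1; starting the iterated
   max at 0 is harmless as the squares are nonnegative. *)
Definition max_sqr (R : realType) (u : nat -> R) (n : nat) : R :=
  \big[Num.max/0]_(1 <= s < n.+1) u s ^+ 2.

(* Main.v *)
Require Import Defs.
From HB Require Import structures.
From mathcomp Require Import all_boot all_order all_algebra.
From mathcomp Require Import all_classical all_reals all_analysis.
From mathcomp Require Import measurable_realfun ring lra.

Import Order.TTheory GRing.Theory Num.Theory.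

Local Open Scope ring_scope.

(* Put d_n = e_n - e_(n-1) and c = 1 - 2 alpha - x - eta. Substituting the
   recurrence into E_(n+1) - E_n gives
     E_(n+1) - E_n = - (n + alpha) (d_(n+1) - d_n)^2
                     - (c + eta) d_(n+1)^2 + 2 (n+1) zeta_n d_(n+1),
   and AM-GM on the last term yields
     E_(n+1) + c d_(n+1)^2 <= E_n + (n+1)^2 zeta_n^2 / eta.
   If c >= 0 this telescopes. If c < 0, then d_(n+1)^2 <= E_(n+1) / (n+1+alpha)
   turns it into E_(n+1) <= r_n (E_n + (n+1)^2 zeta_n^2 / eta) with
   r_n = (n+1+alpha) / (n+2-alpha-x-eta); by the functional equation of Gamma,
   beta_n is the product r_1 ... r_n, and it remains to bound the sum of the
   (k+1)^2 r_k ... r_n by (n-3) (n+1)^2 + 29 beta_n. *)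

(** * One-step energy inequality *)

Lemma energy_step (R : realType) (alpha x eta z : R) (e : nat -> R) (n : nat) :
  -1 < alpha -> 0 < eta -> (1 <= n)%N ->
  e n.+1 = (2 * n%:R + alpha + 1 - x) / n.+1%:R * e n
           - (n%:R + alpha) / n.+1%:R * e n.-1 + z ->
  energy alpha x e n.+1 + (1 - 2 * alpha - x - eta) * (e n.+1 - e n) ^+ 2
  <= energy alpha x e n + n.+1%:R ^+ 2 / eta * z ^+ 2.
Proof.
move=> a1 eta0 n1 rec; rewrite /energy /= -subr_ge0.
have n1R : (1 : R) <= n%:R by rewrite ler1n.
have n0 : n.+1%:R != 0 :> R by rewrite pnatr_eq0.
have nS : n.+1%:R = n%:R + 1 :> R by rewrite -natr1.
set u := e n.+1 in rec *; set v := e n in rec *; set w := e n.-1 in rec *.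
(* The slack is a sum of two squares: the weighted second difference of [e], and the square
   completed in the AM-GM step. *)
suff -> : x * v ^+ 2 + (n%:R + alpha) * (v - w) ^+ 2 +
  n.+1%:R ^+ 2 / eta * z ^+ 2 -
  (x * u ^+ 2 + (n.+1%:R + alpha) * (u - v) ^+ 2 +
   (1 - 2 * alpha - x - eta) * (u - v) ^+ 2) =
  (n%:R + alpha) * ((u - v) - (v - w)) ^+ 2
  + (eta * (u - v) - n.+1%:R * z) ^+ 2 / eta.
  apply: addr_ge0; first by rewrite mulr_ge0 ?sqr_ge0//; lra.
  by rewrite divr_ge0 ?sqr_ge0 // ltW.
rewrite rec nS; rewrite nS in n0.
by field; rewrite n0 gt_eqF.
Qed.

Lemma max_sqr_ge (R : realType) (u : nat -> R) (m n : nat) :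
  (1 <= m <= n)%N -> u m ^+ 2 <= max_sqr u n.
Proof.
move=> mn; rewrite /max_sqr.
by apply: (@le_bigmax_seq _ _ _ _ 0 m _ (fun s => u s ^+ 2)) => //; rewrite mem_index_iota ltnS.
Qed.

(** * Iterating the one-step inequality *)

Section EnergyBounds.
Context {R : realType} (alpha x eta M : R) (e z : nat -> R) (N : nat).
Hypothesis alphaN1 : -1 < alpha.
Hypothesis x0 : 0 < x.
Hypothesis eta0 : 0 < eta.
Hypothesis rec : forall n, (1 <= n)%N ->
  e n.+1 = (2 * n%:R + alpha + 1 - x) / n.+1%:R * e n
           - (n%:R + alpha) / n.+1%:R * e n.-1 + z n.
(** Fixing the horizon [N] and one bound [M] lets the inductions run over n <= N without the maximum
    changing along the way. *)
Hypothesis zM : forall n, (1 <= n <= N)%N -> z n ^+ 2 <= M.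

Lemma energy_step_le n : (1 <= n <= N)%N ->
  energy alpha x e n.+1 + (1 - 2 * alpha - x - eta) * (e n.+1 - e n) ^+ 2
  <= energy alpha x e n + n.+1%:R ^+ 2 / eta * M.
Proof.
move=> /andP[n1 nN]; apply: le_trans (energy_step _ _ _ _ _ _ _ alphaN1 eta0 n1 (rec _ n1)) _.
by rewrite lerD2l ler_wpM2l ?zM ?n1// divr_ge0 ?sqr_ge0// ltW.
Qed.

Lemma energy_le_sum n : (n <= N)%N -> 0 <= 1 - 2 * alpha - x - eta -> 0 <= M ->
  energy alpha x e n.+1
  <= energy alpha x e 1 + ((n.+1 * n.+2 * (2 * n + 3))%:R / 6 - 1) / eta * M.
Proof.
move=> + c0 M0; elim: n => [_|n IH nN].
  rewrite lerDl mulr_ge0// divr_ge0 ?(ltW eta0)//.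
  by rewrite (_ : (1 * 2 * (2 * 0 + 3))%N = 6%N) //; lra.
have := IH (ltnW nN); have := energy_step_le _ (nN : (1 <= n.+1 <= N)%N).
have : 0 <= (1 - 2 * alpha - x - eta) * (e n.+2 - e n.+1) ^+ 2.
  by rewrite mulr_ge0// sqr_ge0.
set F := energy alpha x e.
have -> : ((n.+2 * n.+3 * (2 * n.+1 + 3))%:R / 6 - 1) / eta * M =
  ((n.+1 * n.+2 * (2 * n + 3))%:R / 6 - 1) / eta * M + n.+2%:R ^+ 2 / eta * M.
  rewrite !(natrM, natrD, mulrSr); field; exact: lt0r_neq0.
lra.
Qed.

(** Unfolded: the sum over 1 <= k <= n of (k+1)^2 r_k ... r_n. *)
Fixpoint weighted_sum (r : nat -> R) (n : nat) : R :=
  if n is k.+1 then r n * (weighted_sum r k + n.+1%:R ^+ 2) else 0.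

Lemma energy_le_weighted_sum (r B : nat -> R) n : (n <= N)%N -> B 0%N = 1 ->
  (forall k, B k.+1 = r k.+1 * B k) ->
  (forall k, (1 <= k)%N -> 0 < k%:R + 2 - alpha - x - eta) ->
  (forall k, (1 <= k)%N ->
     r k = (k.+1%:R + alpha) / (k%:R + 2 - alpha - x - eta)) ->
  1 - 2 * alpha - x - eta < 0 ->
  energy alpha x e n.+1
  <= B n * energy alpha x e 1 + weighted_sum r n / eta * M.
Proof.
move=> + B0 BS rpos rE c0; elim: n => [_|n IH nN].
  by rewrite B0 /= !mul0r mul1r addr0.
have {}IH := IH (ltnW nN); have step := energy_step_le _ (nN : (1 <= n.+1 <= N)%N).
have D0 := rpos n.+1 isT.
have nR : 0 <= n%:R :> R by rewrite ler0n.
have n2 : n.+2%:R = n.+1%:R + 1 :> R by rewrite -natr1.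
have n1 : n.+1%:R = n%:R + 1 :> R by rewrite -natr1.
have r0 : 0 < r n.+1 by rewrite rE// divr_gt0//; lra.
have Ele : energy alpha x e n.+2 <= r n.+1 * (energy alpha x e n.+1
    + n.+2%:R ^+ 2 / eta * M).
  (* With c = 1 - 2 alpha - x - eta, the denominator of [r n.+1] is (n+2+alpha) + c. So multiply
     [step] by n+2+alpha and absorb the negative term in c through [d2]. *)
  rewrite rE// mulrAC ler_pdivlMr//.
  have d2 : (n.+2%:R + alpha) * (e n.+2 - e n.+1) ^+ 2 <= energy alpha x e n.+2.
    by rewrite /energy /= lerDr mulr_ge0 ?sqr_ge0// ltW.
  have A0 : 0 < n.+2%:R + alpha by lra.
  have := ler_wpM2l (ltW A0) step.
  have c0' : 0 <= - (1 - 2 * alpha - x - eta) by lra.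
  have := ler_wpM2l c0' d2; rewrite n2; lra.
apply: le_trans Ele _; rewrite BS /=.
rewrite (_ : _ + _ = r n.+1 * (B n * energy alpha x e 1 +
  weighted_sum r n / eta * M + n.+2%:R ^+ 2 / eta * M)); last by ring.
by rewrite (ler_pM2l r0) lerD2r.
Qed.

End EnergyBounds.

(** * Bounding the weighted sum *)

Section WeightedSum.
Context {R : realType} (alpha p : R) (r B : nat -> R).
Hypothesis alpha0 : 0 <= alpha.
Hypothesis p_gt0 : 0 < p.
Hypothesis p_lt : p < 3 / 2.
Hypothesis rE : forall k, (1 <= k)%N ->
  r k = (k.+1%:R + alpha) / (k.+1%:R + alpha - p).
Hypothesis B0 : B 0%N = 1.
Hypothesis BS : forall k, B k.+1 = r k.+1 * B k.

(** [q k] equals r_k - 1, and [T n] is the excess of the weighted sum over the claimed bound; the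
    aim is T n <= 0 for n >= 1. *)
Let q (k : nat) : R := p / (k.+1%:R + alpha - p).
Let T (n : nat) : R :=
  weighted_sum r n - ((n%:R - 3) * n.+1%:R ^+ 2 + 29 * B n).

Let den_gt0 k : (1 <= k)%N -> 0 < k.+1%:R + alpha - p.
Proof.
move: (alpha0) (p_gt0) (p_lt) => a0 p0 p1.
move=> k1; have k1R : 1 <= k%:R :> R by rewrite ler1n.
by rewrite -natr1; lra.
Qed.

Let rq k : (1 <= k)%N -> r k = 1 + q k.
Proof.
move=> k1; move: (den_gt0 _ k1); rewrite rE// /q; move: (k.+1%:R) => a a0.
by field; rewrite gt_eqF.
Qed.

Let q_gt0 k : (1 <= k)%N -> 0 < q k.
Proof. by move=> k1; rewrite divr_gt0 ?den_gt0. Qed.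

Let T0 : T 0 = - 26.
Proof. by rewrite /T B0 /=; lra. Qed.

(** The subtracted polynomial is (n-3)(2n+3): it pushes [T] up before n = 3 and down after. With all
    [q] set to 0, the first three steps add 9, 10 and 7 to -26 and reach exactly 0, which explains
    the constant 29. *)
Let TS n : T n.+1 = (1 + q n.+1) * T n
  + q n.+1 * (n%:R * (n%:R ^+ 2 - 1) + 1) - (2 * n%:R ^+ 2 - 3 * n%:R - 9).
Proof. by rewrite /T BS /= rq// !mulrSr; ring. Qed.

(* This slack at n = 3 pays for the increase of [T] in the steps up to n = 7,
   where the polynomial step used for larger n is not yet available. *)
Let T3 : T 3 <= - 25 * q 1 - 16 * q 2.
Proof.
rewrite !TS T0.
have := mulr_gt0 (q_gt0 1 isT) (q_gt0 2 isT).
have := mulr_gt0 (q_gt0 1 isT) (q_gt0 3 isT).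
have := mulr_gt0 (q_gt0 2 isT) (q_gt0 3 isT).
have := mulr_gt0 (mulr_gt0 (q_gt0 1 isT) (q_gt0 2 isT)) (q_gt0 3 isT).
lra.
Qed.

Let q_anti j k : (1 <= j <= k)%N -> q k <= q j.
Proof.
move=> /andP[j1 jk]; rewrite ler_pM2l// lef_pV2 ?posrE ?den_gt0//.
  by rewrite lerD2r lerD2r ler_nat ltnS.
exact: leq_trans jk.
Qed.

Let q_le k (c : R) : (1 <= k)%N -> p <= c * (k.+1%:R + alpha - p) -> q k <= c.
Proof. by move=> k1 pc; rewrite ler_pdivrMr ?den_gt0. Qed.

(** At n = 3 the subtracted polynomial vanishes and n(n^2-1)+1 = 25. *)
Let T4 : T 4 <= 25 * q 4 - 25 * q 1 - 16 * q 2.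
Proof.
rewrite TS; have := T3; have := q_gt0 1 isT; have := q_gt0 2 isT.
move=> q2 q1 t3; have t3' : T 3 <= 0 by lra.
have := mulr_ge0_le0 (ltW (q_gt0 4 isT)) t3'; lra.
Qed.

Let T_step n : T n <= 0 -> T n.+1 <= T n
  + q n.+1 * (n%:R * (n%:R ^+ 2 - 1) + 1) - (2 * n%:R ^+ 2 - 3 * n%:R - 9).
Proof.
move=> Tn; rewrite TS; have := mulr_ge0_le0 (ltW (q_gt0 n.+1 isT)) Tn; lra.
Qed.

Let q1_ge (c : R) : 0 <= c -> 0 <= (5 + alpha - p) - c * (2 + alpha - p) ->
  c * q 4 <= q 1.
Proof.
move: (alpha0) (p_gt0) (p_lt) => a0 p0 p1.
move=> c0 H; rewrite /q mulrA ler_pdivrMr ?den_gt0// mulrAC.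
rewrite ler_pdivlMr ?den_gt0// [c * p]mulrC -!mulrA ler_pM2l//; lra.
Qed.

Let T_le0_4567 n : (4 <= n <= 7)%N -> T n <= 0.
Proof.
move: (alpha0) (p_gt0) (p_lt) => a0 p0 p1.
have t4 := T4; have q4 := q_gt0 4 isT; have q2 := q_gt0 2 isT.
have q5 := q_gt0 5 isT.
have q42 : q 4 <= q 2 by apply: q_anti.
have q52 : q 5 <= q 2 by apply: q_anti.
have q54 : q 5 <= q 4 by apply: q_anti.
have q41 : q 4 <= q 1 by apply: q_anti.
have t4' : T 4 <= 0 by lra.
have t5 := T_step _ t4'.
suff [t5' t6' t7'] : [/\ T 5 <= 0, T 6 <= 0 & T 7 <= 0].
  by case: n => [|[|[|[|[|[|[|[|]]]]]]]].
(* The cuts at alpha - p = -1/2 and 1 are where q_1 = 3 q_4 and q_1 = 2 q_4. A small alpha - p makes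
   q_1 large, so [T 4] is very negative; a large one makes the later [q] small. The fractions below
   come from p < 3/2 and the lower bound on alpha - p in each case. *)
have [h1|h1] := lerP alpha (p - 1 / 2).
  have q1 : 3 * q 4 <= q 1 by apply: q1_ge; lra.
  have t5' : T 5 <= 0 by lra.
  have t6 := T_step _ t5'.
  have q6 : q 6 <= 3 / 11 by apply: q_le => //; lra.
  have t6' : T 6 <= 0 by lra.
  have t7 := T_step _ t6'.
  have q7 : q 7 <= 3 / 13 by apply: q_le => //; lra.
  by split=> //; lra.
have q7 : q 7 <= 1 / 5 by apply: q_le => //; lra.
have [h2|h2] := lerP alpha (p + 1).
  have q1 : 2 * q 4 <= q 1 by apply: q1_ge; lra.
  have q5' : q 5 <= 3 / 11 by apply: q_le => //; lra.
  have t5' : T 5 <= 0 by lra.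
  have t6 := T_step _ t5'.
  have q6 : q 6 <= 3 / 13 by apply: q_le => //; lra.
  have t6' : T 6 <= 0 by lra.
  have t7 := T_step _ t6'.
  by split=> //; lra.
have q5' : q 5 <= 3 / 14 by apply: q_le => //; lra.
have t5' : T 5 <= 0 by lra.
have t6 := T_step _ t5'.
have q6 : q 6 <= 3 / 16 by apply: q_le => //; lra.
have t6' : T 6 <= 0 by lra.
have t7 := T_step _ t6'.
by split=> //; lra.
Qed.

Lemma weighted_sum_le n : (1 <= n)%N ->
  weighted_sum r n <= (n%:R - 3) * n.+1%:R ^+ 2 + 29 * B n.
Proof.
move=> n1; rewrite -subr_le0 -/(T n).
have [n7|] := leqP n 7.
  have q1 := q_gt0 1 isT; have q2 := q_gt0 2 isT.
  have q12 := mulr_gt0 q1 q2.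
  case: n n1 n7 => [//|[_ _|[_ _|[_ _|n _ n7]]]].
  - by rewrite TS T0; lra.
  - by rewrite !TS T0; lra.
  - by have := T3; lra.
  - by apply: T_le0_4567; rewrite n7.
(* Induction from 8 on; its first step starts from the case n = 7 settled above. *)
elim: n {n1} => // n IH n7; have Tn : T n <= 0.
  have [n7'|/IH//] := leqP n 7.
  by apply: T_le0_4567; rewrite n7'; rewrite ltnS in n7; rewrite (leq_trans _ n7).
apply: le_trans (T_step _ Tn) _.
move: (alpha0) (p_gt0) (p_lt) => a0 p0 p1.
have n7R : 7 <= n%:R :> R by rewrite ler_nat -ltnS.
have DE : n%:R + 1 / 2 <= n.+2%:R + alpha - p by rewrite -(@natr1 _ n.+1) -(@natr1 _ n); lra.
move: DE (den_gt0 n.+1 isT); rewrite /q; move: (_ - p) => D DE D0.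
suff : p / D * (n%:R * (n%:R ^+ 2 - 1) + 1) <= 2 * n%:R ^+ 2 - 3 * n%:R - 9 by lra.
rewrite mulrAC ler_pdivrMr//.
(* Since p < 3/2 and D >= n + 1/2, it suffices that (3/2)(n^3-n+1) <= (n+1/2)(2n^2-3n-9). This first
   holds at n = 7, and in m = n - 7 the difference has only positive coefficients. *)
have [m nm] : exists m : R, n%:R = 7 + m by exists (n%:R - 7); lra.
have m0 : 0 <= m by lra.
rewrite nm in DE *.
have m2 : 0 <= m ^+ 2 by rewrite sqr_ge0.
have m3 : 0 <= m ^+ 3 by rewrite exprn_ge0.
have P0 : 0 <= (7 + m) * ((7 + m) ^+ 2 - 1) + 1 by lra.
apply: (@le_trans _ _ (3 / 2 * ((7 + m) * ((7 + m) ^+ 2 - 1) + 1))).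
  by rewrite ler_wpM2r// ltW.
have Q0 : 0 <= 2 * (7 + m) ^+ 2 - 3 * (7 + m) - 9 by lra.
have := ler_wpM2l Q0 DE; lra.
Qed.

End WeightedSum.

(** * Functional equation and positivity of Gamma *)

Section GammaIntegral.
Import numFieldNormedType.Exports.
Local Open Scope classical_set_scope.
Context {R : realType}.
Notation mu := (@lebesgue_measure R).
Implicit Types (z t a b : R) (n : nat).

Let f z t : R := t `^ z * expR (- t).
(** Compact intervals exhausting the positive half-line; the shift by 2 keeps the endpoints
    distinct. *)
Let J n : set R := `[n.+2%:R^-1, n.+2%:R].

Let f_ge0 z t : 0 <= f z t.
Proof. by rewrite mulr_ge0 ?powR_ge0 ?expR_ge0. Qed.

Let measurable_f z (D : set R) : measurable_fun D (f z).
Proof.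
apply: measurable_funTS; apply: measurable_funM; first exact: measurable_powR.
apply: measurableT_comp; first exact: measurable_expR.
by [].
Qed.

Let is_derive_f z t : 0 < t -> is_derive t 1 (f z) (z * f (z - 1) t - f z t).
Proof.
move=> t0; rewrite /f.
have -> : z * (t `^ (z - 1) * expR (- t)) - t `^ z * expR (- t) =
  t `^ z *: (- 1 *: expR (- t)) + expR (- t) *: (z * t `^ (z - 1)).
  by rewrite /GRing.scale /=; ring.
apply: is_deriveM; first exact: is_derive1_powR.
rewrite [X in is_derive _ _ _ X]mulrC.
by apply: (@is_derive1_comp _ expR (fun t => - t)).
Qed.

(** From ln u <= u - 1 at u = t / (2z), which trades t^z for half of the exponential decay. *)
Let f_bound z t : 0 < z -> 0 < t ->
  f z t <= expR (z * ln (2 * z) - z) * expR (- (t / 2)).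
Proof.
move=> z0 t0; rewrite /f /powR gt_eqF// -!expRD ler_expR.
have z20 : 0 < 2 * z by rewrite mulr_gt0.
have u0 : 0 < t / (2 * z) by rewrite divr_gt0.
have /le_ln1Dx : -1 < t / (2 * z) - 1 by lra.
rewrite addrC subrK lnM ?posrE ?invr_gt0// lnV ?posrE// => H.
have := ler_wpM2l (ltW z0) H.
have -> : z * (t / (2 * z) - 1) = t / 2 - z by field; rewrite gt_eqF.
lra.
Qed.

Let J_gt0 n t : J n t -> 0 < t.
Proof.
rewrite /J /= in_itv/= => /andP[+ _]; apply: lt_le_trans.
by rewrite invr_gt0 ltr0n.
Qed.

Let measurable_J n : measurable (J n).
Proof. exact: measurable_itv. Qed.

Let J_lt n : (n.+2%:R^-1 : R) < n.+2%:R.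
Proof.
apply: (@lt_le_trans _ _ 1); last by rewrite ler1n.
by rewrite invf_lt1 ?ltr0n// ltr1n.
Qed.

Let continuous_J (g : R -> R) n :
  (forall t, 0 < t -> derivable g t 1) -> {within J n, continuous g}.
Proof.
by move=> dg; apply: derivable_within_continuous => t /J_gt0 /dg.
Qed.

Let integrable_J (g : R -> R) n : (forall t, 0 < t -> derivable g t 1) ->
  mu.-integrable (J n) (EFin \o g).
Proof.
move=> dg; apply: continuous_compact_integrable; first exact: segment_compact.
exact: continuous_J.
Qed.

Let derivable_f z t : 0 < t -> derivable (f z) t 1.
Proof. by move=> /(is_derive_f z)[]. Qed.

Let FTC2_J (h g : R -> R) n :
  (forall t, 0 < t -> is_derive t 1 h (g t)) ->
  (forall t, 0 < t -> derivable g t 1) ->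
  (\int[mu]_(t in J n) (g t)%:E = (h n.+2%:R)%:E - (h n.+2%:R^-1)%:E)%E.
Proof.
move=> dh dg.
have ch t : 0 < t -> {for t, continuous h}.
  move=> /dh[dht _]; apply: differentiable_continuous.
  exact/derivable1_diffP.
apply: (@continuous_FTC2 _ g h _ _ (J_lt n)); first exact: continuous_J.
- split.
  + move=> t /andP[+ _]; rewrite bnd_simp => tl.
    by have [] : is_derive t 1 h (g t) by apply/dh/(le_lt_trans _ tl).
  + by apply/cvg_at_right_filter/ch; rewrite invr_gt0 ltr0n.
  + by apply/cvg_at_left_filter/ch; rewrite ltr0n.
- move=> t /andP[+ _]; rewrite bnd_simp => tl.
  have [_ <-] : is_derive t 1 h (g t) by apply/dh/(le_lt_trans _ tl).
  by rewrite derive1E.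
Qed.

Let cvg_int_J (z : R) :
  (fun n => \int[mu]_(t in J n) (f z t)%:E)%E @ \oo
  --> (\int[mu]_(t in `]0%R, +oo[) (f z t)%:E)%E.
Proof.
have -> : `]0%R, +oo[%classic = \bigcup_n J n.
  apply/seteqP; split => t; last by case=> n _ /J_gt0; rewrite /= in_itv/= => ->.
  rewrite /= in_itv/= andbT => t0.
  (* This index dominates both t and 1/t. *)
  exists (Num.truncn (t + t^-1)) => //=.
  have tV0 : 0 < t^-1 by rewrite invr_gt0.
  have /truncn_itv /andP[_] : 0 <= t + t^-1 by rewrite addr_ge0 ?ltW.
  set N := Num.truncn _ => NS.
  have NS2 : t + t^-1 <= N.+2%:R.
    by apply: (le_trans (ltW NS)); rewrite ler_nat.
  rewrite /J /= in_itv/=; apply/andP; split.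
    rewrite -[leRHS]invrK lef_pV2 ?posrE ?ltr0n//; lra.
  lra.
apply: ge0_nondecreasing_set_cvg_integral => //.
- move=> m n mn; apply/subsetPset; rewrite /J => t /=; rewrite !in_itv/=.
  move=> /andP[t1 t2]; apply/andP; split.
    by apply: le_trans t1; rewrite lef_pV2 ?posrE ?ltr0n// ler_nat.
  by apply: (le_trans t2); rewrite ler_nat.
- by move=> n; apply/measurable_EFinP; exact: measurable_f.
- by move=> n t _; rewrite lee_fin f_ge0.
Qed.

(** Integration by parts: the derivative of [f z] is z f(z-1) - f(z). *)
Let int_J_rec (z : R) n :
  (z%:E * \int[mu]_(t in J n) (f (z - 1) t)%:E =
   \int[mu]_(t in J n) (f z t)%:E + (f z n.+2%:R - f z n.+2%:R^-1)%:E)%E.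
Proof.
have dzf t : 0 < t -> derivable (fun t => z * f (z - 1) t) t 1.
  by move=> t0; apply: derivableM => //; exact: derivable_f.
have dg t : 0 < t -> derivable (fun t => z * f (z - 1) t - f z t) t 1.
  by move=> t0; apply: derivableB; [exact: dzf|exact: derivable_f].
have := FTC2_J _ _ n (is_derive_f z) dg.
under eq_integral do rewrite EFinB.
have mJ := measurable_J n; have ig := integrable_J _ n (derivable_f (z - 1)).
rewrite integralB_EFin//; [|exact: integrable_J|by apply/integrable_J/derivable_f].
under eq_integral do rewrite EFinM.
rewrite integralZl//.
have : (\int[mu]_(t in J n) (f z t)%:E)%E \is a fin_num.
  by apply: integrable_fin_num => //; apply/integrable_J/derivable_f.
move=> ffin H; rewrite EFinB -H addeC subeK//.
Qed.

Let f_cvg0_infty (z : R) : 0 < z -> f z n.+2%:R @[n --> \oo] --> 0.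
Proof.
move=> z0; set C := expR (z * ln (2 * z) - z).
apply: (@squeeze_cvgr _ _ _ _ (cst 0) (fun n => C * expR (- (n.+2%:R / 2)))).
- by apply: nearW => n; rewrite f_ge0 /=; apply: f_bound => //; rewrite ltr0n.
- exact: cvg_cst.
rewrite -[X in _ --> X](mulr0 C); apply: cvgMl_tmp.
apply: (@cvg_comp _ _ _ (fun n => n.+2%:R) (fun t => expR (- (t / 2))) _ +oo).
  have := @cvgr_idn R; rewrite -(cvg_shiftn 2); apply: cvg_trans.
  by apply: near_eq_cvg; apply: nearW => n /=; rewrite addn2.
apply: (@cvg_comp _ _ _ (fun t => t / 2) (fun t => expR (- t)) _ +oo).
  by apply: gt0_cvgMly; rewrite ?invr_gt0.
exact: cvgr_expR.
Qed.

Let f_cvg0_0 (z : R) : 0 < z -> f z n.+2%:R^-1 @[n --> \oo] --> 0.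
Proof.
move=> z0; apply: (@squeeze_cvgr _ _ _ _ (cst 0) (fun n => n.+2%:R^-1 `^ z)).
- by apply: nearW => n; rewrite f_ge0 /= ler_piMr ?powR_ge0// expR_le1 oppr_le0.
- exact: cvg_cst.
move/cvg_at_rightP : (powR_cvg0 z0); apply; split.
  by move=> n; rewrite invr_gt0 ltr0n.
have := @cvg_harmonic R; rewrite -(cvg_shiftn 1) /harmonic; apply: cvg_trans.
by apply: near_eq_cvg; apply: nearW => n /=; rewrite addn1.
Qed.

(** The boundary terms of [int_J_rec] tend to 0. Working in the extended reals allows the limit
    before finiteness is known. *)
Let integral_f_rec (z : R) : 0 < z ->
  (z%:E * \int[mu]_(t in `]0%R, +oo[) (f (z - 1) t)%:E =
   \int[mu]_(t in `]0%R, +oo[) (f z t)%:E)%E.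
Proof.
move=> z0.
have E0 : (fun n => (f z n.+2%:R - f z n.+2%:R^-1)%:E) @ \oo --> 0%E.
  apply: cvg_EFin; first exact: nearW.
  rewrite -[X in _ --> X](subr0 (0 : R)).
  by apply: cvgB; [exact: f_cvg0_infty|exact: f_cvg0_0].
have I0 : (\int[mu]_(t in `]0%R, +oo[) (f z t)%:E +? 0)%E.
  by rewrite fin_num_adde_defl.
have := cvgeD I0 (cvg_int_J z) E0; rewrite adde0.
under eq_fun do rewrite -int_J_rec.
move=> /(_ _)/cvg_lim <- //; apply/esym/cvg_lim => //.
by apply: cvgeZl (cvg_int_J (z - 1)).
Qed.

Let integral_f_lty (z : R) : 0 < z ->
  (\int[mu]_(t in `]0%R, +oo[) (f z t)%:E < +oo)%E.
Proof.
move=> z0; set C := expR (z * ln (2 * z) - z).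
have C0 : 0 < C by exact: expR_gt0.
suff: (\int[mu]_(t in `]0%R, +oo[) (f z t)%:E <= (2 * C)%:E)%E.
  by move/le_lt_trans; apply; rewrite ltry.
apply: cvge_le (cvg_int_J z); apply: nearW => n.
(* [h] is an antiderivative of the dominating function [g], so every integral over [J n] is at most
   2C. *)
pose h t := - (2 * C) * expR (- (t / 2)).
pose g t := C * expR (- (t / 2)).
have de t : is_derive t 1 (fun t : R => expR (- (t / 2))) (expR (- (t / 2)) * - (1 / 2)).
  apply: (@is_derive1_comp _ expR (fun t => - (t / 2))).
  apply: is_deriveN; rewrite (_ : 1 / 2 = 2^-1 *: 1); last by rewrite /GRing.scale/= mulrC.
  rewrite (_ : (fun t => t / 2) = (2^-1 \*: id)); first exact: is_deriveZ.
  by apply/funext => u /=; rewrite /GRing.scale/= mulrC.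
have dh t : 0 < t -> is_derive t 1 h (g t).
  move=> _; rewrite (_ : g t = - (2 * C) *: (expR (- (t / 2)) * - (1 / 2))).
    exact: is_deriveZ.
  by rewrite /g /GRing.scale /=; field.
have dg t : 0 < t -> derivable g t 1.
  by move=> _; apply: derivableZ; case: (de t).
have fg : (\int[mu]_(t in J n) (f z t)%:E <= \int[mu]_(t in J n) (g t)%:E)%E.
  apply: le_integral; first exact: measurable_J.
  - by apply/integrable_J/derivable_f.
  - exact: integrable_J.
  - move=> t; rewrite inE => /J_gt0 t0; rewrite lee_fin; exact: f_bound.
apply: (le_trans fg); rewrite (FTC2_J _ _ _ dh dg) -EFinB lee_fin /h.
have e0 : 0 < expR (- (n.+2%:R / 2)) :> R by exact: expR_gt0.
have e1 : expR (- (n.+2%:R^-1 / 2)) <= 1 :> R.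
  by rewrite expR_le1 oppr_le0 divr_ge0 ?invr_ge0 ?ler0n.
have := mulr_gt0 C0 e0; have := ler_wpM2l (ltW C0) e1; lra.
Qed.

(** For z < 1 the integrand is unbounded near 0 and [f_bound] does not apply; finiteness is pulled
    back from [f z] through the recurrence. *)
Let integral_f_fin_num (z : R) : 0 < z ->
  (\int[mu]_(t in `]0%R, +oo[) (f (z - 1) t)%:E)%E \is a fin_num.
Proof.
move=> z0; have I0 : (0 <= \int[mu]_(t in `]0%R, +oo[) (f (z - 1) t)%:E)%E.
  by apply: integral_ge0 => t _; rewrite lee_fin f_ge0.
rewrite ge0_fin_numE//; have := integral_f_lty _ z0; rewrite -integral_f_rec//.
by move: (integral _ _ _) I0 => [r|//|//] _; rewrite ?ltry// gt0_muley ?lte_fin.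
Qed.

Lemma GammaD1 (z : R) : 0 < z -> Gamma (z + 1) = z * Gamma z.
Proof.
move=> z0; rewrite /Gamma /Rintegral -/(f _ _).
have := integral_f_rec _ z0; rewrite /f addrK => <-.
by rewrite fineM// integral_f_fin_num.
Qed.

Lemma Gamma_gt0 (z : R) : 0 < z -> 0 < Gamma z.
Proof.
move=> z0; rewrite /Gamma /Rintegral -lte_fin fineK ?integral_f_fin_num//.
(* On [1, 2] the integrand is at least t^(-1) e^(-t) >= e^(-2) / 2, because z - 1 > -1. *)
have c0 : 0 < 2^-1 * expR (-2) :> R by rewrite mulr_gt0 ?invr_gt0 ?expR_gt0.
apply: (@lt_le_trans _ _ (\int[mu]_(t in `[1%R, 2%R]) (cst (2^-1 * expR (-2))%:E) t)%E).
  rewrite integral_cst//= lebesgue_measure_itv /= lte_fin ltr1n -EFinB -EFinM lte_fin.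
  by rewrite mulr_gt0//; lra.
apply: (@le_trans _ _ (\int[mu]_(t in `[1%R, 2%R]) (f (z - 1) t)%:E)%E).
  apply: ge0_le_integral => //.
  - by move=> t _; rewrite lee_fin; exact: ltW c0.
  - by apply/measurable_EFinP; exact: measurable_f.
  move=> t; rewrite /= in_itv/= => /andP[t1 t2]; rewrite lee_fin /f.
  have t0 : 0 < t by apply: lt_le_trans t1.
  apply: ler_pM; rewrite ?expR_ge0// ?ler_expR ?lerN2//.
  apply: (@le_trans _ _ (t `^ (-1))).
    by rewrite powR_inv1 ?(ltW t0)// lef_pV2 ?posrE.
  by apply: ler_powR => //; lra.
apply: ge0_subset_integral => //.
- by apply/measurable_EFinP; exact: measurable_f.
- by move=> t _; rewrite lee_fin f_ge0.
- move=> t; rewrite /= !in_itv/= andbT => /andP[+ _]; exact: lt_le_trans.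
Qed.

End GammaIntegral.

(** * Recurrence for beta_n and the two estimates *)

Lemma beta_coef0 (R : realType) (alpha x eta : R) :
  - 2 < alpha -> 0 < 3 - alpha - x - eta -> beta_coef alpha x eta 0 = 1.
Proof.
move=> a2 D0; rewrite /beta_coef !add0r !divff ?invr1 ?mulr1 ?gt_eqF//.
all: by apply: Gamma_gt0; lra.
Qed.

Lemma beta_coefS (R : realType) (alpha x eta : R) (n : nat) :
  - 2 < alpha -> 0 < 3 - alpha - x - eta ->
  beta_coef alpha x eta n.+1 =
  (n%:R + 2 + alpha) / (n%:R + 3 - alpha - x - eta) * beta_coef alpha x eta n.
Proof.
move=> a2 D0; have n0 : 0 <= n%:R :> R by [].
rewrite /beta_coef.
have -> : n.+1%:R + 2 + alpha = (n%:R + 2 + alpha) + 1 by rewrite -natr1; ring.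
have -> : n.+1%:R + 3 - alpha - x - eta = (n%:R + 3 - alpha - x - eta) + 1.
  by rewrite -natr1; ring.
rewrite !GammaD1; [|lra|lra].
by rewrite !invfM !invrK; ring.
Qed.

Theorem mainTheorem1 (R : realType) (alpha x : R)
    (etax : R) (etaa etab : nat -> R) (e : nat -> R)
    (halpha : -1 < alpha) (hx : 0 < x)
    (he0 : e 0%N = 0)
    (he1 : e 1%N = (laguerre alpha 1).[x] * etaa 0%N)
    (herec : forall n : nat, (1 <= n)%N ->
       e n.+1 = (2 * n%:R + alpha + 1 - x) / n.+1%:R * e n
                - (n%:R + alpha) / n.+1%:R * e n.-1
                + zeta alpha x etax etaa etab e n)
    (eta : R) (heta : 0 < eta) (hpos : 0 < 3 - alpha - x - eta)
    (n : nat) (hn : (1 <= n)%N) :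
  (0 <= 1 - 2 * alpha - x - eta ->
     energy alpha x e n.+1
     <= energy alpha x e 1
        + (n.+1 * n.+2 * (2 * n + 3))%:R / (6 * eta)
          * max_sqr (zeta alpha x etax etaa etab e) n)
  /\
  (- (3 / 2) < 1 - 2 * alpha - x - eta -> 1 - 2 * alpha - x - eta < 0 ->
   0 <= alpha ->
     energy alpha x e n.+1
     <= beta_coef alpha x eta n * energy alpha x e 1
        + ((n%:R - 3) * n.+1%:R ^+ 2 + 29 * beta_coef alpha x eta n) / eta
          * max_sqr (zeta alpha x etax etaa etab e) n).
Proof.
set z := zeta alpha x etax etaa etab e in herec *.
have zM k : (1 <= k <= n)%N -> z k ^+ 2 <= max_sqr z n.
  by move=> kn; exact: max_sqr_ge.
have M0 : 0 <= max_sqr z n by rewrite (le_trans _ (zM 1%N _)) ?sqr_ge0 ?hn.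
split=> [c0|c32 c0 a0].
  apply: (le_trans (energy_le_sum _ _ _ _ _ _ _ halpha heta herec zM _ _ c0 M0)) => //.
  (* Only the summand -1 of the exact sum of squares is given up. *)
  rewrite lerD2l invfM mulrA ler_wpM2r// ler_wpM2r ?invr_ge0 ?ltW//; lra.
pose r k : R := (k.+1%:R + alpha) / (k%:R + 2 - alpha - x - eta).
have B0 : beta_coef alpha x eta 0 = 1 by apply: beta_coef0; lra.
have BS k : beta_coef alpha x eta k.+1 = r k.+1 * beta_coef alpha x eta k.
  rewrite beta_coefS//; last lra.
  by rewrite /r; congr (_ / _ * _); rewrite -!natr1; ring.
have rpos k : (1 <= k)%N -> 0 < k%:R + 2 - alpha - x - eta.
  by move=> k1; have : 1 <= k%:R :> R by [rewrite ler1n]; lra.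
apply: (le_trans (energy_le_weighted_sum _ _ _ _ _ _ _ halpha hx heta herec zM
  r _ _ (leqnn n) B0 BS rpos _ c0)) => //.
rewrite lerD2l ler_wpM2r// ler_wpM2r ?invr_ge0 ?(ltW heta)//.
(* Here p = -c, so 0 < p < 3/2 is precisely the range of c assumed in (ii). *)
apply: (@weighted_sum_le _ alpha (2 * alpha + x + eta - 1) r (beta_coef alpha x eta)) => //; [lra|lra|].
by move=> k k1; rewrite /r; congr (_ / _); rewrite -natr1; ring.
Qed.
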